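(* Let $(\bar{x},\bar{y})\in X_{\rm LP}$. Suppose that $|T|\ge 2$, that $a_q\le b_1$ for all $q\in Q$, that $b_1r+c<a_q$ for all $q\in Q$, that $\sum_{q\in Q}a_q\le b_t+c$ for all $t\in T\setminus\{1\}$, that $$\sum_{q\in Q}a_q-a_{\bar{q}}\le b_1(r+1)+c<\sum_{q\in Q}a_q\qquad\text{for all }\bar{q}\in Q,$$ and that $\sum_{t\in T\setminus\{1\}}\bar{y}_t<1$. Let $\tilde{Q}=\{q\in Q:\bar{x}_q>\sum_{t\in T\setminus\{1\}}\bar{y}_t\}$. Then the following hold. (a) If $\tilde{Q}=\varnothing$, the inequality $0\le y_1+r\sum_{t\in T\setminus\{1\}}y_t-r$ solves the separation problem for $(\bar{x},\bar{y})$. (b) If $\tilde{Q}\ne\varnothing$ and $\tilde{Q}\ne Q$, the inequality $x_d\le y_1+(r+1)\sum_{t\in T\setminus\{1\}}y_t-r$ solves the separation problem for $(\bar{x},\bar{y})$. (c) If $\tilde{Q}=Q$ and $|Q|\le 2$, the inequality $\sum_{q\in Q}x_q\le y_1+(r+|Q|)\sum_{t\in T\setminus\{1\}}y_t-r$ solves the separation problem for $(\bar{x},\bar{y})$. (d) If $\tilde{Q}=Q$ and $|Q|\ge 3$, then, writing $\sigma=\dfrac{\sum_{q\in Q}\bar{x}_q-\sum_{t\in T\setminus\{1\}}\bar{y}_t}{|Q|-1}$, the separation problem for $(\bar{x},\bar{y})$ is solved by the inequality $$\begin{cases} x_d\le y_1+(r+1)\displaystyle\sum_{t\in T\setminus\{1\}}y_t-r,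 & \text{if }\sigma\le\bar{x}_d;\\[2mm] \dfrac{1}{|Q|-1}\displaystyle\sum_{q\in Q}x_q\le y_1+\Big(r+\dfrac{|Q|}{|Q|-1}\Big)\sum_{t\in T\setminus\{1\}}y_t-r, & \text{if }\bar{x}_d<\sigma\le 1;\\[2mm] \displaystyle\sum_{q\in Q}x_q\le y_1+(r+2)\sum_{t\in T\setminus\{1\}}y_t-r+|Q|-2, & \text{if }\sigma>1.\end{cases}$$ Moreover, in all four cases (a)–(d), the listed inequalities define facets of the polyhedron $P$.
   Context: $Q$ is a finite set, $T=\{1,\ldots,|T|\}\neq\varnothing$, $0<b_1\le\cdots\le b_{|T|}$ are real numbers, $a_q>0$ for all $q\in Q$, $c\in\mathbb{R}$, and $\sum_{q\in Q}a_q-c>0$. The unsplittable flow arc-set is $$X=\Big\{(x,y)\in\{0,1\}^{|Q|}\times\mathbb{Z}_+^{|T|}:\ \sum_{q\in Q}a_qx_q\le\sum_{t\in T}b_ty_t+c\Big\},$$ $P=\mathrm{conv}(X)$, and $X_{\rm LP}=\{(x,y)\in[0,1]^{|Q|}\times\mathbb{R}_+^{|T|}:\sum_{q\in Q}a_qx_q\le\sum_{t\in T}b_ty_t+c\}$. Let $r=\max\{\lceil -c/b_1\rceil,0\}$ and let $d\in\operatorname{argmax}_q\{\bar{x}_q:q\in Q\}$ (used only when $Q\neq\varnothing$). Separation problem for $(\bar{x},\bar{y})$: with $(x^1,y^1),\ldots,(x^u,y^u)$ the vertices of $P$, $$\max_{\alpha,\beta,\gamma}\ \bar{x}^{\top}\alpha-\bar{y}^{\top}\beta-\gamma\quad\text{s.t.}\quad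 (x^k)^{\top}\alpha-(y^k)^{\top}\beta-\gamma\le 0\ (k=1,\ldots,u),\quad \beta_1=1,\quad \beta_t\ge 0\ (t\in T\setminus\{1\}),$$ over $(\alpha,\beta,\gamma)\in\mathbb{R}^{|Q|}\times\mathbb{R}^{|T|}\times\mathbb{R}$. An inequality $\alpha^{\top}x\le\beta^{\top}y+\gamma$ is said to solve the separation problem if $(\alpha,\beta,\gamma)$ is an optimal solution of this problem. *)

(* Defs.v *)
From mathcomp Require Import all_boot all_order all_algebra.
From mathcomp Require Import interval_inference.
From mathcomp Require Import classical_sets reals convex.

Set Implicit Arguments.
Unset Strict Implicit.
Unset Printing Implicit Defensive.

Import Order.TTheory GRing.Theory Num.Theory.
Local Open Scope classical_set_scope.
Local Open Scope ring_scope.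

Definition conv_hull (R : realType) (E : lmodType R) (X : set E) : set E :=
  smallest (@convex_set R E) X.

Definition is_vertex (R : realType) (E : lmodType R) (P : set E) (v : E) : Prop :=
  P v /\ forall (p q : E) (l : R), P p -> P q -> 0 < l < 1 ->
           v = l *: p + (1 - l) *: q -> p = q.

Definition affinely_independent (R : realType) (E : vectType R) (s : seq E) : bool :=
  if s is p0 :: s' then free [seq p - p0 | p <- s'] else true.

(* The empty set has no dimension in this sense; its usual dimension is -1. *)
Definition has_dim (R : realType) (E : vectType R) (S : set E) (k : nat) : Prop :=
  (exists s : seq E, [/\ {in s, forall p, S p}, affinely_independent s
                       & size s = k.+1]) /\
  (forall s : seq E, {in s, forall p, S p} -> affinely_independent s ->
     (size s <= k.+1)%N).

(* The space R^Q x R^T with T = {1, ..., n+1}; the element t of T is encoded by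
   the ordinal t - 1, so that ord0 stands for 1.  The alias R^o provides the
   vector space structure. *)
Notation point R Q n := ({ffun Q -> R^o} * {ffun 'I_n.+1 -> R^o})%type.

(* The inequality  alpha^T x <= beta^T y + gamma. *)
Record ineq (R : realType) (Q : finType) (n : nat) := Ineq {
  ialpha : Q -> R;
  ibeta : 'I_n.+1 -> R;
  igamma : R }.

Definition violation (R : realType) (Q : finType) (n : nat)
    (I : ineq R Q n) (z : point R Q n) : R :=
  \sum_q ialpha I q * z.1 q - \sum_t ibeta I t * z.2 t - igamma I.

Definition flow_arc_set (R : realType) (Q : finType) (n : nat)
    (a : Q -> R) (b : 'I_n.+1 -> R) (c : R) : set (point R Q n) :=
  [set z : point R Q n | [/\ forall q, z.1 q = 0 :> R \/ z.1 q = 1 :> R,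
               forall t, exists m : nat, z.2 t = m%:R :> R
             & \sum_q a q * z.1 q <= \sum_t b t * z.2 t + c]].

Definition flow_arc_polyhedron (R : realType) (Q : finType) (n : nat)
    (a : Q -> R) (b : 'I_n.+1 -> R) (c : R) : set (point R Q n) :=
  conv_hull (flow_arc_set a b c).

Definition flow_arc_LP (R : realType) (Q : finType) (n : nat)
    (a : Q -> R) (b : 'I_n.+1 -> R) (c : R) : set (point R Q n) :=
  [set z : point R Q n | [/\ forall q, 0 <= z.1 q <= 1,
               forall t, 0 <= z.2 t
             & \sum_q a q * z.1 q <= \sum_t b t * z.2 t + c]].

Definition separation_feasible (R : realType) (Q : finType) (n : nat)
    (P : set (point R Q n)) (I : ineq R Q n) : Prop :=
  [/\ forall v, is_vertex P v -> violation I v <= 0,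
      ibeta I ord0 = 1
    & forall t, t != ord0 -> 0 <= ibeta I t].

Definition solves_separation (R : realType) (Q : finType) (n : nat)
    (P : set (point R Q n)) (zbar : point R Q n) (I : ineq R Q n) : Prop :=
  separation_feasible P I /\
  forall J, separation_feasible P J -> violation J zbar <= violation I zbar.

Definition defines_facet (R : realType) (Q : finType) (n : nat)
    (P : set (point R Q n)) (I : ineq R Q n) : Prop :=
  (forall z, P z -> violation I z <= 0) /\
  exists k, has_dim P k.+1 /\ has_dim (P `&` [set z : point R Q n | violation I z = 0]) k.

(* alpha^T x <= y_1 + beta * \sum_(t in T \ {1}) y_t + gamma *)
Definition first_rest_ineq (R : realType) (Q : finType) (n : nat)
    (alpha : Q -> R) (beta gamma : R) : ineq R Q n :=
  Ineq alpha (fun t => if t == ord0 then 1 else beta) gamma.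

(* Main.v *)
From HB Require Import structures.
From mathcomp Require Import all_boot all_order all_algebra.
From mathcomp Require Import interval_inference.
From mathcomp Require Import classical_sets reals convex.
From mathcomp Require Import lra ring.
Require Import Defs.

Set Implicit Arguments.
Unset Strict Implicit.
Unset Printing Implicit Defensive.

Import Order.TTheory GRing.Theory Num.Theory.
Local Open Scope ring_scope.

(** Write [s] for the total of the [ybar t] with [t != ord0], and call the axis
    point [axis_point A t k] the pair of the indicator of [A] and [k] units of
    the single facility [t].  Under the hypotheses the arc-set has a very simple
    shape.  One unit of any facility other than the first one serves every [A].
    With the first facility alone one climbs a staircase: level [r] serves only
    the empty set, level [r + 1] serves every proper subset of [Q], and level
    [r + 2] serves [Q] itself.

    Optimality is linear programming duality, with the dual solution kept
    implicit.  An inequality feasible for the separation problem is satisfied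
    by every axis point of the arc-set ([feasible_axis]): lowering [k] as far
    as possible gives a vertex of the convex hull ([axis_vertex]), and raising
    it again only helps since the coefficients of [y] are nonnegative.  Cut
    [xbar q] into [Order.min (xbar q) s] and the excess
    [Order.max 0 (xbar q - s)].  The first part, of size at most [s], is paid
    for by the axis points of the facilities other than the first one, with
    weights [ybar t].  The excess lies in a box of side [1 - s], and is paid
    for by the staircase with the remaining weight [1 - s]
    ([violation_bound]).  There the three levels give exactly two bounds: one
    for a point of the box, cut by the condition that removes the corner [Q]
    ([punctured_box_bound]), and one for a point of the simplex at that corner
    ([corner_bound]).  In every case of the theorem one of the two bounds
    equals the violation of the listed inequality.

    A listed inequality defines a facet because it is valid on the arc-set
    and tight at [#|Q| + n + 1] affinely independent axis points.  Independence
    is proved by spanning: the differences of these points and the unit vector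
    of [y_1] generate the whole space ([facet_criterion]). *)

(** * Affine inequalities on convex hulls *)

Section Hull.
Context (R : realType).

Definition affine (E : lmodType R) (f : E -> R) : Prop :=
  forall (l : R) p q, f (l *: p + (1 - l) *: q) = l * f p + (1 - l) * f q.

Lemma conv_hull_le0 (E : lmodType R) (X : set E) (f : E -> R) :
  affine f -> (forall z, X z -> f z <= 0) ->
  forall z, conv_hull X z -> f z <= 0.
Proof.
move=> faff fX; apply: smallest_sub; last exact: fX.
move=> p q l; rewrite !in_setE /= => fp fq.
have [l0 l1] : 0 <= l%:num /\ l%:num <= 1 by split; [exact: ge0|exact: le1].
change (f (l%:num *: p + (1 - l%:num) *: q) <= 0).
by rewrite faff -oppr_ge0 opprD -!mulrN addr_ge0 ?mulr_ge0 ?oppr_ge0 ?subr_ge0.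
Qed.

Lemma conv_hull_ge0 (E : lmodType R) (X : set E) (f : E -> R) :
  affine f -> (forall z, X z -> 0 <= f z) ->
  forall z, conv_hull X z -> 0 <= f z.
Proof.
move=> faff fX z Xz; rewrite -oppr_le0.
apply: (conv_hull_le0 (f := fun z => - f z)) Xz => [l p q|w /fX].
  by rewrite faff opprD !mulrN.
by rewrite oppr_le0.
Qed.

Lemma conv_hull_sub (E : lmodType R) (X : set E) z : X z -> conv_hull X z.
Proof. exact: sub_gen_smallest. Qed.

Lemma convex_comb_eq0 (l u v : R) : 0 < l < 1 -> 0 <= u -> 0 <= v ->
  l * u + (1 - l) * v = 0 -> u = 0 /\ v = 0.
Proof.
move=> /andP[l0 l1] u0 v0 /eqP; have l1' : 0 < 1 - l by rewrite subr_gt0.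
rewrite paddr_eq0 ?mulr_ge0 ?(ltW l0) ?(ltW l1')// !mulf_eq0.
by rewrite (gt_eqF l0) (gt_eqF l1')/= => /andP[/eqP-> /eqP->].
Qed.

Lemma convex_comb_subr (l u v k : R) :
  l * (u - k) + (1 - l) * (v - k) = l * u + (1 - l) * v - k.
Proof. ring. Qed.

Lemma convex_comb_subl (l u v k : R) :
  l * (k - u) + (1 - l) * (k - v) = k - (l * u + (1 - l) * v).
Proof. ring. Qed.

End Hull.

(** * Axis points and vertices of the arc polyhedron *)

Section Points.
Context (R : realType) (Q : finType) (n : nat).
Implicit Types (I J : ineq R Q n) (A : {set Q}) (t : 'I_n.+1).

Lemma violation_affine I : affine (violation I).
Proof.
move=> l p q; rewrite /violation /=.
have comb (K : finType) (w : K -> R) (u v : {ffun K -> R^o}) :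
    \sum_i w i * (l *: u + (1 - l) *: v) i =
    l * (\sum_i w i * u i) + (1 - l) * (\sum_i w i * v i).
  rewrite !mulr_sumr -big_split; apply: eq_bigr => i _.
  by rewrite !ffunE /GRing.scale /=; ring.
rewrite !comb; ring.
Qed.

Definition axis_point A t (k : nat) : point R Q n :=
  ([ffun q => (q \in A)%:R], [ffun i => if i == t then k%:R else 0]).

Lemma sum_axis (f : 'I_n.+1 -> R) A t k :
  \sum_i f i * (axis_point A t k).2 i = f t * k%:R.
Proof.
rewrite (bigD1 t)//= ffunE eqxx big1 ?addr0// => i /negPf it.
by rewrite ffunE it mulr0.
Qed.

Lemma sum_indicator (f : Q -> R) A t k :
  \sum_q f q * (axis_point A t k).1 q = \sum_(q in A) f q.
Proof.
rewrite [RHS]big_mkcond; apply: eq_bigr => q _; rewrite ffunE.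
by case: (q \in A); rewrite ?mulr1 ?mulr0.
Qed.

Lemma violation_axis I A t k : violation I (axis_point A t k) =
  \sum_(q in A) ialpha I q - ibeta I t * k%:R - igamma I.
Proof. by rewrite /violation sum_indicator sum_axis. Qed.

Lemma violation_first_rest (alpha : Q -> R) (beta gamma : R) z :
  violation (first_rest_ineq n alpha beta gamma) z =
  \sum_q alpha q * z.1 q - z.2 ord0 - beta * \sum_(t | t != ord0) (z.2 t : R) - gamma.
Proof.
rewrite /violation /= (bigD1 ord0)//= mul1r mulr_sumr opprD addrA.
by congr (_ - _ - _); apply: eq_bigr => t /negPf ->.
Qed.

Section FlowArc.
Context (a : Q -> R) (b : 'I_n.+1 -> R) (c : R).
Let X := flow_arc_set a b c.
Let P := flow_arc_polyhedron a b c.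

Lemma axis_flow_arc A t k :
  X (axis_point A t k) <-> \sum_(q in A) a q <= b t * k%:R + c.
Proof.
split=> [[_ _]|H]; first by rewrite sum_indicator sum_axis.
split; last by rewrite sum_indicator sum_axis.
- by move=> q; rewrite ffunE; case: (q \in A); [right|left].
- by move=> i; rewrite ffunE; case: eqP => _; [exists k|exists 0%N].
Qed.

Lemma flow_arc_cases z : X z ->
  1 <= \sum_(t | t != ord0) (z.2 t : R) \/
  exists A m, z = axis_point A ord0 m.
Proof.
move=> [z01 zN _].
have y0 t : 0 <= (z.2 t : R) by have [m ->] := zN t.
have [/forallP rest0|] := boolP [forall t, (t != ord0) ==> (z.2 t == 0)].
  right; exists [set q | z.1 q == 1 :> R]%SET; have [m mE] := zN ord0; exists m.
  rewrite [z]surjective_pairing; congr (_, _); apply/ffunP => i; rewrite ffunE.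
    by rewrite inE; case: (z01 i) => ->; rewrite ?eqxx// eq_sym oner_eq0.
  by have := rest0 i; case: eqP => [-> //|_ /eqP].
rewrite negb_forall => /existsP[t]; rewrite negb_imply => /andP[t0 zt]; left.
rewrite (bigD1 t)//=; apply: ler_wpDr; first by rewrite sumr_ge0.
by move: zt; have [m ->] := zN t; rewrite pnatr_eq0 ler1n lt0n.
Qed.

Lemma hull_x_itv z q : P z -> 0 <= (z.1 q : R) <= 1.
Proof.
move=> Pz; apply/andP; split.
  apply: (conv_hull_ge0 (X := X) (f := fun z : point R Q n => z.1 q)) Pz.
    by move=> l p p'; rewrite !ffunE.
  by move=> w [/(_ q)[|] -> _ _].
rewrite -subr_ge0.
apply: (conv_hull_ge0 (X := X) (f := fun z : point R Q n => 1 - z.1 q)) Pz.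
  move=> l p p'; rewrite !ffunE.
  by rewrite /GRing.scale /=; ring.
by move=> w [/(_ q)[|] -> _ _]; rewrite ?subr0 ?subrr.
Qed.

Lemma hull_y_ge0 z t : P z -> 0 <= (z.2 t : R).
Proof.
apply: (conv_hull_ge0 (X := X) (f := fun z : point R Q n => z.2 t)) => [l p p'|].
  by rewrite !ffunE.
by move=> w [_ /(_ t)[m ->] _].
Qed.

(** The function [z.2 t + k * dist z] is minimal on the hull at the axis point:
    at an integral point either [dist] vanishes, and the point lies on the same
    axis, or [dist] is at least 1 and the term [k * dist z] alone reaches [k].
    The same bound and the bounds on the coordinates are then tight at both
    ends of a segment through the axis point, which determines these ends. *)
Lemma axis_vertex A t k : X (axis_point A t k) ->
  (forall m, X (axis_point A t m) -> (k <= m)%N) ->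
  is_vertex P (axis_point A t k).
Proof.
move=> Xz kmin; split; first exact: conv_hull_sub.
(* [dist z] is the l1 distance from [z] to the axis, for [z] in the hull. *)
pose dist (z : point R Q n) : R :=
  \sum_q (if q \in A then 1 - z.1 q else z.1 q) + \sum_(i | i != t) z.2 i.
have dist_aff : affine dist.
  move=> l p q; rewrite /dist.
  pose dx (z : point R Q n) i : R := if i \in A then 1 - z.1 i else z.1 i.
  have -> : \sum_i (dx (l *: p + (1 - l) *: q) i) =
      l * (\sum_i dx p i) + (1 - l) * (\sum_i dx q i).
    rewrite !mulr_sumr -big_split; apply: eq_bigr => i _.
    by rewrite /dx !ffunE /GRing.scale /=; case: ifP => _; ring.
  have -> : \sum_(i | i != t) ((l *: p + (1 - l) *: q).2 i : R) =
      l * (\sum_(i | i != t) (p.2 i : R)) + (1 - l) * (\sum_(i | i != t) (q.2 i : R)).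
    by rewrite !mulr_sumr -big_split; apply: eq_bigr => i _; rewrite !ffunE.
  by rewrite /dx; ring.
have valid z : P z -> 0 <= (z.2 t : R) + k%:R * dist z - k%:R.
  apply: (conv_hull_ge0 (f := fun z : point R Q n =>
    (z.2 t : R) + k%:R * dist z - k%:R)) => [l p q|w Xw].
    by rewrite dist_aff !ffunE /GRing.scale /=; ring.
  have [w01 wN wle] := Xw.
  have wx_ge0 q : 0 <= (if q \in A then 1 - w.1 q else w.1 q) :> R.
    by case: (w01 q) => ->; case: ifP; rewrite ?subr0 ?subrr.
  have wy_ge0 i : 0 <= w.2 i :> R by have [m ->] := wN i.
  have wt0 := wy_ge0 t.
  have [/andP[/forallP wA /forallP w0]|] := boolP
      ([forall q, w.1 q == (q \in A)%:R] && [forall i, (i != t) ==> (w.2 i == 0)]).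
    have w0' i : i != t -> w.2 i = 0 :> R.
      by move=> it; have := w0 i; rewrite it => /eqP.
    have -> : dist w = 0.
      have -> : dist w = \sum_i (if i \in A then 1 - w.1 i else w.1 i).
        by rewrite /dist [X in _ + X]big1 ?addr0.
      apply: big1 => i _.
      by rewrite (eqP (wA i)); case: (i \in A); rewrite ?subrr.
    rewrite mulr0 addr0 subr_ge0; have [m wm] := wN t; rewrite wm ler_nat.
    apply: kmin; suff <- : w = axis_point A t m by [].
    rewrite [w]surjective_pairing; congr (_, _); apply/ffunP => i.
      by rewrite ffunE; apply/eqP/wA.
    rewrite ffunE; case: eqP => [->//|/eqP it]; exact: w0'.
  move=> far; suff : 1 <= dist w by move=> ?; have := ler0n R k; nra.
  move: far; rewrite negb_and !negb_forall => /orP[/existsP[q wq]|/existsP[i]].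
    rewrite /dist (bigD1 q)//= -addrA; apply: ler_wpDr.
      by rewrite addr_ge0 ?sumr_ge0.
    by move: wq; case: (w01 q) => ->; case: (q \in A); rewrite ?eqxx ?subr0.
  rewrite negb_imply => /andP[it wi].
  rewrite /dist (bigD1 i)//= addrCA; apply: ler_wpDr; first by rewrite addr_ge0 ?sumr_ge0.
  by move: wi; have [m ->] := wN i; rewrite pnatr_eq0 ler1n lt0n.
move=> p q l Pp Pq l01 zE.
have {}zE : [/\ forall i, (i \in A)%:R = l * p.1 i + (1 - l) * q.1 i :> R
   & forall i, (if i == t then k%:R else 0) = l * p.2 i + (1 - l) * q.2 i :> R].
  split=> i.
    by have /(congr1 (fun z : point R Q n => z.1 i)) := zE; rewrite !ffunE.
  by have /(congr1 (fun z : point R Q n => z.2 i)) := zE; rewrite !ffunE.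
have [xE yE] := zE.
have eqx i : p.1 i = (i \in A)%:R :> R /\ q.1 i = (i \in A)%:R :> R.
  have /andP[pi0 pi1] := hull_x_itv i Pp; have /andP[qi0 qi1] := hull_x_itv i Pq.
  have := xE i; case: (i \in A) => /esym E; last exact: (convex_comb_eq0 l01).
  have p0 : 0 <= 1 - (p.1 i : R) by rewrite subr_ge0.
  have q0 : 0 <= 1 - (q.1 i : R) by rewrite subr_ge0.
  have E' : l * (1 - p.1 i) + (1 - l) * (1 - q.1 i) = 0.
    by rewrite convex_comb_subl E subrr.
  by have [] := convex_comb_eq0 l01 p0 q0 E'; split; apply/esym/subr0_eq.
have eqy i : i != t -> p.2 i = 0 :> R /\ q.2 i = 0 :> R.
  move=> it; have := yE i; rewrite (negPf it) => /esym E.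
  by apply: (convex_comb_eq0 l01) E; exact: hull_y_ge0.
have dist0 (z : point R Q n) : (forall i, z.1 i = (i \in A)%:R :> R) ->
    (forall i, i != t -> z.2 i = 0 :> R) -> dist z = 0.
  move=> zx zy; rewrite /dist [X in _ + X]big1// addr0 big1// => i _.
  by rewrite zx; case: (i \in A); rewrite ?subrr.
have dp : dist p = 0 by apply: dist0 => i; [case: (eqx i)|case/eqy].
have dq : dist q = 0 by apply: dist0 => i; [case: (eqx i)|case/eqy].
have := valid p Pp; have := valid q Pq.
rewrite dp dq mulr0 !addr0 => qt pt.
have tE : l * ((p.2 t : R) - k%:R) + (1 - l) * ((q.2 t : R) - k%:R) = 0.
  have := yE t; rewrite eqxx => E.
  by rewrite convex_comb_subr -E subrr.
have [/subr0_eq ptk /subr0_eq qtk] := convex_comb_eq0 l01 pt qt tE.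
rewrite [p]surjective_pairing [q]surjective_pairing.
congr (_, _); apply/ffunP => i; first by case: (eqx i) => -> ->.
have [->|/eqy[-> ->]//] := eqVneq i t; by rewrite ptk qtk.
Qed.

(** Not every axis point is a vertex (for instance, with [A] empty and [t] not
    the first facility, it is not one when the origin belongs to the arc-set),
    hence the descent to the least level on the same axis. *)
Lemma feasible_axis J A t k : separation_feasible P J ->
  X (axis_point A t k) -> violation J (axis_point A t k) <= 0.
Proof.
move=> [Jv J1 Jge0] Xk.
have ex : exists m, \sum_(q in A) a q <= b t * m%:R + c.
  by exists k; apply/axis_flow_arc.
case: (ex_minnP ex) => m Xm mmin.
have le_mk : (m <= k)%N by apply/mmin/axis_flow_arc.
have := Jv (axis_point A t m).
rewrite !violation_axis => Jm; apply: le_trans (Jm _).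
  rewrite lerD2r lerB// ler_wpM2l ?ler_nat//.
  by have [->|/Jge0//] := eqVneq t ord0; rewrite J1.
apply: axis_vertex => [|m' /axis_flow_arc /mmin//].
exact/axis_flow_arc.
Qed.

End FlowArc.
End Points.

Arguments axis_point {R Q n} A t k.

(** * Linear forms on boxes *)

Section LinearBounds.
Context (R : realType) (Q : finType).
Implicit Types (w u : Q -> R).
Local Notation N := (#|Q|%:R : R).

Lemma sum_const (g : R) : \sum_(q : Q) g = N * g.
Proof. by rewrite sumr_const mulr_natl. Qed.

Lemma setC1_neqT (q : Q) : [set~ q]%SET <> [set: Q]%SET.
Proof. by move/setP/(_ q); rewrite !inE eqxx. Qed.

Lemma card_setC1R (q : Q) : #|[set~ q]%SET|%:R = N - 1.
Proof. by rewrite cardsC1 -subn1 natrB//; apply/card_gt0P; exists q. Qed.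

Lemma card_proper_le (A : {set Q}) : A <> [set: Q]%SET -> #|A|%:R <= N - 1.
Proof.
move=> /eqP; rewrite -properT => /proper_card; rewrite cardsT => AQ.
by rewrite lerBrDr natr1 ler_nat.
Qed.

Lemma sum1_A (A : {set Q}) : \sum_(q in A) 1 = #|A|%:R :> R.
Proof. by rewrite sumr_const. Qed.

Lemma sum_average (A : {set Q}) :
  \sum_(q in A) 1 / (N - 1) = #|A|%:R / (N - 1) :> R.
Proof. by rewrite sumr_const -[LHS]mulr_natl mulrA mulr1. Qed.

Lemma sum_excess (xbar : {ffun Q -> R^o}) (s : R) :
  (forall q, s <= (xbar q : R)) ->
  \sum_q Order.max 0 ((xbar q : R) - s) = \sum_q (xbar q : R) - N * s.
Proof.
move=> xs; rewrite -sum_const -sumrB; apply: eq_bigr => q _.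
by rewrite max_r// subr_ge0.
Qed.

Lemma average_shift (v m x s : R) :
  v - s <= x * (m - 1) -> v - m * s <= (m - 1) * (x - s).
Proof. lra. Qed.

Lemma box_bound w u (g : R) : (forall q, 0 <= u q <= g) ->
  \sum_q w q * u q <= g * \sum_(q in [set q | 0 < w q]%SET) w q.
Proof.
move=> u_box; rewrite mulr_sumr [leRHS]big_mkcond; apply: ler_sum => q _.
rewrite inE; have /andP[u0 ug] := u_box q.
by case: ltP => w0; nra.
Qed.

(** The points considered are [g] times those in the convex hull of the
    indicators of the proper subsets of [Q], so that it suffices to find one
    good proper subset.  If some coefficient is nonpositive, it is the set of
    the positive ones.  Otherwise all coefficients are positive, and the
    cheapest way to lower the coordinates of the full corner by a total of [g]
    is at an index [q0] of least coefficient; the set is the complement of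
    [q0]. *)
Lemma punctured_box_bound w u (g m : R) :
  (forall A : {set Q}, A <> [set: Q]%SET -> \sum_(q in A) w q <= m) ->
  0 <= g -> (forall q, 0 <= u q <= g) -> \sum_q u q <= (N - 1) * g ->
  \sum_q w q * u q <= g * m.
Proof.
move=> w_le g0 u_box sum_u.
have [d wd0|w_gt0] := pickP [pred q | w q <= 0].
  apply: le_trans (box_bound w u_box) _; apply: ler_wpM2l => //; apply: w_le.
  by move=> /setP/(_ d); rewrite !inE ltNge (wd0 : w d <= 0).
have {}w_gt0 q : 0 < w q by rewrite ltNge [_ <= _]w_gt0.
(* For empty [Q] the cut reads [0 <= - g], so that [g] is 0. *)
have [q1 _|Q0] := pickP (@predT Q); last first.
  have -> : g = 0.
    move: sum_u; rewrite big_pred0 // (eq_card0 (Q0 : Q =i pred0)); lra.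
  rewrite mul0r big_pred0 //.
case: (Order.TotalTheory.arg_minP w (erefl : predT q1)) => q0 _ w_min.
have E : \sum_q w q * u q = g * (\sum_q w q) - \sum_q w q * (g - u q).
  by rewrite mulr_sumr -sumrB; apply: eq_bigr => q _; ring.
have q0_le : w q0 * g <= \sum_q w q * (g - u q).
  apply: (@le_trans _ _ (\sum_q w q0 * (g - u q))); last first.
    apply: ler_sum => q _; rewrite ler_wpM2r ?w_min//.
    by rewrite subr_ge0; case/andP: (u_box q).
  rewrite -mulr_sumr ler_wpM2l ?(ltW (w_gt0 _))// sumrB sum_const; lra.
have : \sum_q w q - w q0 <= m.
  have -> : \sum_q w q - w q0 = \sum_(q in [set~ q0]%SET) w q.
    rewrite [X in X - _](bigD1 q0)//= addrAC subrr add0r; apply: eq_bigl => q.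
    by rewrite !inE.
  by apply: w_le; exact: setC1_neqT.
rewrite E; nra.
Qed.

(** Near the full corner, [u] is a combination of [Q], with weight
    [h - (N * h - \sum_q u q)], and of the sets [Q] minus [q], with weights
    [h - u q]. *)
Lemma corner_bound w u (h m : R) :
  \sum_q w q <= m + 2 -> (forall q, \sum_q' w q' - w q <= m + 1) ->
  (forall q, u q <= h) -> N * h - \sum_q u q <= h ->
  \sum_q w q * u q <= h * m + \sum_q u q - N * h + 2 * h.
Proof.
move=> full_le almost_le u_le sum_u; set S := \sum_q w q in full_le almost_le.
have E : \sum_q w q * u q = h * S - \sum_q w q * (h - u q).
  by rewrite mulr_sumr -sumrB; apply: eq_bigr => q _; ring.
have : \sum_q (S - m - 1) * (h - u q) <= \sum_q w q * (h - u q).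
  apply: ler_sum => q _; rewrite ler_wpM2r ?subr_ge0//.
  by have := almost_le q; lra.
rewrite -mulr_sumr sumrB sum_const E; nra.
Qed.

End LinearBounds.

(** * A facet criterion *)

Section Facet.
Context (R : realType) (Q : finType) (n : nat).

Lemma dim_point : dim (point R Q n) = (#|Q| + n.+1)%N.
Proof.
transitivity (#|Q| * 1 + #|'I_n.+1| * 1)%N; first by [].
by rewrite !muln1 card_ord.
Qed.

Definition xunit q : point R Q n := ([ffun i => (i == q)%:R], 0).
Definition yunit t : point R Q n := (0, [ffun i => (i == t)%:R]).

Lemma point_span (V : {vspace (point R Q n)}) :
  (forall q, xunit q \in V) -> (forall t, yunit t \in V) -> V = fullv.
Proof.
move=> xV yV; apply/eqP; rewrite eqEsubv subvf; apply/subvP => z _.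
have -> : z = \sum_q (z.1 q : R) *: xunit q + \sum_t (z.2 t : R) *: yunit t.
  rewrite [LHS]surjective_pairing; congr (_, _); apply/ffunP => i /=.
    rewrite !(raddf_sum (@fst _ _)) /= ffunE !sum_ffunE (bigD1 i)//= !ffunE eqxx.
    rewrite big1 => [|j /negPf ji]; last by rewrite !ffunE eq_sym ji mulr0n scaler0.
    rewrite big1 => [|j _]; last by rewrite scaler0 ffunE.
    by rewrite !addr0; exact/esym/mulr1.
  rewrite !(raddf_sum (@snd _ _)) /= ffunE !sum_ffunE (bigD1 (i : 'I_n.+1))//= !ffunE eqxx.
  rewrite [X in _ + (_ + X)]big1 => [|j /negPf ji]; last first.
    by rewrite !ffunE eq_sym ji mulr0n scaler0.
  rewrite big1 => [|j _]; last by rewrite scaler0 ffunE.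
  by rewrite add0r addr0; exact/esym/mulr1.
by rewrite rpredD// rpred_sum// => i _; rewrite rpredZ.
Qed.

(** Adding [igamma I] back cancels the constant term of the violation. *)
Definition lin_part (I : ineq R Q n) (z : point R Q n) : R^o :=
  violation I z + igamma I.

Lemma lin_part_linear I : linear (lin_part I).
Proof.
move=> l p q; rewrite /lin_part /violation !subrK.
have comb (K : finType) (w : K -> R) (u v : {ffun K -> R^o}) :
    \sum_i w i * (l *: u + v) i = l * (\sum_i w i * u i) + \sum_i w i * v i.
  rewrite mulr_sumr -big_split; apply: eq_bigr => i _.
  by rewrite !ffunE /GRing.scale /=; ring.
rewrite !comb /GRing.scale /=; ring.
Qed.

HB.instance Definition _ I :=
  GRing.isLinear.Build R (point R Q n) R^o _ (lin_part I) (@lin_part_linear I).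

Lemma lin_part_yunit I t : lin_part I (yunit t) = - ibeta I t.
Proof.
rewrite /lin_part /violation subrK big1 ?sub0r => [|q _]; last first.
  by rewrite ffunE mulr0.
congr (- _); rewrite (bigD1 t)//= ffunE eqxx mulr1 big1 ?addr0// => i /negPf it.
by rewrite ffunE it mulr0.
Qed.

(** The unit vector of [y_1] is transversal to the face since its coefficient
    is not zero.  Together with the differences of the tight points it
    generates the space and has the right number of members, so it is free;
    this yields the dimension of the hull, with the extra point
    [p0 + yunit ord0], and a lower bound on that of the face.  Conversely
    any affinely independent family of the face stays free when that unit
    vector is added to its differences, as the latter lie in the kernel of
    [lin_part I]. *)
Lemma facet_criterion (X : set (point R Q n)) (I : ineq R Q n)
    (p0 : point R Q n) (pQ : Q -> point R Q n) (pT : 'I_n -> point R Q n) :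
  ibeta I ord0 = 1 -> (forall z, X z -> violation I z <= 0) ->
  X p0 -> X (p0 + yunit ord0) -> (forall q, X (pQ q)) -> (forall t, X (pT t)) ->
  violation I p0 = 0 -> (forall q, violation I (pQ q) = 0) ->
  (forall t, violation I (pT t) = 0) ->
  (forall V : {vspace (point R Q n)}, yunit ord0 \in V ->
    (forall q, pQ q - p0 \in V) -> (forall t, pT t - p0 \in V) ->
    (forall q, xunit q \in V) /\ (forall t, yunit (lift ord0 t) \in V)) ->
  defines_facet (conv_hull X) I.
Proof.
move=> I1 IX Xp0 Xp1 XpQ XpT Ip0 IpQ IpT spanV.
split; first exact: (conv_hull_le0 (@violation_affine _ _ _ I)).
exists (#|Q| + n)%N.
pose pts := codom pQ ++ codom pT.
have size_pts : size pts = (#|Q| + n)%N.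
  by rewrite /pts size_cat !size_codom card_ord.
have ptsX p : p \in pts -> X p /\ violation I p = 0.
  by rewrite mem_cat => /orP[] /codomP[i ->].
pose D := [seq p - p0 | p <- pts].
have freeD : free (yunit ord0 :: D).
  suff spanD : <<yunit ord0 :: D>>%VS = fullv.
    by rewrite /free spanD dimvf dim_point /= size_map size_pts addnS.
  have y0D : yunit ord0 \in <<yunit ord0 :: D>>%VS by rewrite memv_span ?mem_head.
  have [||xD yD] := spanV <<yunit ord0 :: D>>%VS y0D.
  - move=> q; rewrite memv_span// inE; apply/orP; right.
    by apply: (map_f (fun p => p - p0)); rewrite mem_cat codom_f.
  - move=> t; rewrite memv_span// inE; apply/orP; right.
    by apply: (map_f (fun p => p - p0)); rewrite mem_cat codom_f orbT.
  by apply: point_span => // t; case: (unliftP ord0 t) => [j|] ->.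
split; split.
- exists [:: p0, p0 + yunit ord0 & pts]; split.
  + move=> p; rewrite !inE => /or3P[/eqP->|/eqP->|/ptsX[]].
    * exact: conv_hull_sub.
    * exact: conv_hull_sub.
    * by move=> Xp _; exact: conv_hull_sub.
  + by rewrite /= addrAC subrr add0r.
  + by rewrite /= size_pts.
- move=> [//|p s] _ /=; rewrite /free size_map => /eqP <-.
  by rewrite ltnS (leq_trans (dimvS (subvf _)))// dimvf dim_point addnS.
- exists (p0 :: pts); split.
  + by move=> p; rewrite inE => /orP[/eqP->|/ptsX[]]; split=> //; exact: conv_hull_sub.
  + by move: freeD; rewrite free_cons => /andP[].
  + by rewrite /= size_pts.
- move=> [//|p s] sI /= free_s.
  have : free (yunit ord0 :: [seq q - p | q <- s]).
    rewrite free_cons free_s andbT; apply/negP.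
    have /subvP sub : (<<[seq q - p | q <- s]>> <= lker (linfun (lin_part I)))%VS.
      apply/span_subvP => _ /mapP[q qs ->]; rewrite memv_ker lfunE /= linearB /=.
      have [_ Iq] : (conv_hull X `&` [set z | violation I z = 0])%classic q.
        by apply: sI; rewrite inE qs orbT.
      have [_ Ip] := sI p (mem_head _ _).
      by rewrite /lin_part Iq Ip subrr.
    move=> /sub; rewrite memv_ker lfunE /= lin_part_yunit I1.
    by rewrite oppr_eq0 oner_eq0.
  rewrite {1}/free /= size_map => /eqP sizeE.
  rewrite ltnS -ltnS -sizeE (leq_trans (dimvS (subvf _)))// dimvf dim_point.
  by rewrite addnS.
Qed.

Lemma axis_pointE A t k :
  axis_point A t k = \sum_(q in A) xunit q + (k%:R : R) *: yunit t.
Proof.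
congr (_, _); apply/ffunP => i; rewrite !(raddf_sum (@fst _ _), raddf_sum (@snd _ _)) /=.
  rewrite scaler0 addr0 sum_ffunE ffunE big_mkcond (bigD1 i)//= ffunE eqxx.
  rewrite big1 ?addr0 => [|q /negPf qi]; first by case: (i \in A).
  by rewrite ffunE eq_sym qi; case: ifP.
rewrite big1 // !ffunE add0r; case: (i == t).
  exact/esym/mulr1.
exact/esym/mulr0.
Qed.

Lemma axis_pointS A t k : axis_point A t k + yunit t = axis_point A t k.+1.
Proof. by rewrite !axis_pointE -addrA -[k.+1%:R]natr1 scalerDl scale1r. Qed.

Lemma mem_axis_first (V : {vspace (point R Q n)}) A k : yunit ord0 \in V ->
  (axis_point A ord0 k \in V) = (\sum_(q in A) xunit q \in V).
Proof. by move=> yV; rewrite axis_pointE rpredDr// rpredZ. Qed.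

Lemma sum_xunit_setT q :
  \sum_(q' in [set: Q]%SET) xunit q' =
  xunit q + \sum_(q' in [set~ q]%SET) xunit q'.
Proof.
rewrite (bigD1 q) ?inE//=; congr (_ + _); apply: eq_bigl => q'.
by rewrite !inE.
Qed.

End Facet.

(** * The staircase *)

(** The upper estimate of level [r + 1] is only assumed for inhabited [Q]: for
    empty [Q] the full vector is [x = 0], which is served at level [r]. *)
Record staircase (R : realType) (Q : finType) (n : nat)
    (a : Q -> R) (b : 'I_n.+1 -> R) (c : R) (r : nat) : Prop := Staircase {
  stair_b1_gt0 : 0 < b ord0;
  stair_feasible : 0 <= b ord0 * r%:R + c;
  stair_min : forall m : nat, 0 <= b ord0 * m%:R + c -> (r <= m)%N;
  stair_a_gt0 : forall q, 0 < a q;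
  stair_a_le : forall q, a q <= b ord0;
  stair_lt_a : forall q, b ord0 * r%:R + c < a q;
  stair_rest : forall t, t != ord0 -> \sum_q a q <= b t + c;
  stair_ge : forall q0, \sum_q a q - a q0 <= b ord0 * (r%:R + 1) + c;
  stair_lt : Q -> b ord0 * (r%:R + 1) + c < \sum_q a q }.

Section Staircase.
Context (R : realType) (Q : finType) (n : nat).
Context (a : Q -> R) (b : 'I_n.+1 -> R) (c : R) (r : nat).
Context (St : staircase a b c r).
Let b1_gt0 := stair_b1_gt0 St.
Let r_feasible := stair_feasible St.
Let r_min := stair_min St.
Let a_gt0 := stair_a_gt0 St.
Let a_le := stair_a_le St.
Let lt_a := stair_lt_a St.
Let big_b := stair_rest St.
Let step_ge := stair_ge St.
Let step_lt := stair_lt St.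
Implicit Types A : {set Q}.
Local Notation X := (flow_arc_set a b c).
Local Notation P := (flow_arc_polyhedron a b c).
Local Notation N := (#|Q|%:R : R).

Lemma sum_a_sub A : \sum_(q in A) a q <= \sum_q a q.
Proof.
rewrite big_mkcond; apply: ler_sum => q _.
by case: ifP => // _; exact: ltW.
Qed.

Lemma mem_rest A (t : 'I_n.+1) : t != ord0 -> X (axis_point A t 1).
Proof.
move=> t0; apply/axis_flow_arc; rewrite mulr1.
exact: le_trans (sum_a_sub A) (big_b t0).
Qed.

Lemma mem_first_mono A k m : (k <= m)%N ->
  X (axis_point A ord0 k) -> X (axis_point A ord0 m).
Proof.
move=> km /axis_flow_arc Xk; apply/axis_flow_arc; apply: le_trans Xk _.
by rewrite lerD2r ler_wpM2l ?ler_nat // ltW.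
Qed.

Lemma mem_first0 : X (axis_point finset.set0 ord0 r).
Proof. by apply/axis_flow_arc; rewrite big_set0. Qed.

Lemma mem_first1 A : A <> [set: Q]%SET -> X (axis_point A ord0 r.+1).
Proof.
move=> /eqP; rewrite -properT => /properP[_ [q0 _ q0A]].
apply/axis_flow_arc; rewrite -natr1; apply: le_trans (step_ge q0).
rewrite big_mkcond (bigD1 q0)//= (negPf q0A) add0r [X in _ <= X - _](bigD1 q0)//=.
rewrite addrAC subrr add0r; apply: ler_sum => q _.
by case: ifP => // _; exact: ltW.
Qed.

Lemma mem_first2 A : X (axis_point A ord0 r.+2).
Proof.
have [->|/eqP AT] := eqVneq A [set: Q]%SET; last first.
  exact: mem_first_mono (mem_first1 AT).
have [q0 _|Q0] := pickP (@predT Q); last first.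
  rewrite (_ : [set: Q]%SET = finset.set0); last by apply/setP => q; have := Q0 q.
  by apply: mem_first_mono mem_first0; rewrite -addn2 leq_addr.
apply/axis_flow_arc; have := step_ge q0; have := a_le q0.
under [X in _ -> _ -> X <= _]eq_bigl => q do rewrite inE.
by rewrite -[r.+2]addn2 natrD; lra.
Qed.

Lemma first_axis_ge A m : X (axis_point A ord0 m) -> (r + (A != finset.set0) <= m)%N.
Proof.
move=> /axis_flow_arc Xm.
have rm : (r <= m)%N.
  by apply: r_min; apply: le_trans Xm; rewrite sumr_ge0// => q _; exact: ltW.
have [_|/set0Pn[q qA]] := eqVneq A finset.set0; first by rewrite addn0.
rewrite addn1 ltn_neqAle rm andbT; apply/eqP => E.
have := lt_a q; rewrite ltNge E; apply/negP; rewrite negbK.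
apply: le_trans Xm; rewrite (bigD1 q)//= lerDl sumr_ge0// => q' _; exact: ltW.
Qed.

Lemma first_full_ge m : (0 < #|Q|)%N ->
  X (axis_point [set: Q]%SET ord0 m) -> (r.+2 <= m)%N.
Proof.
move=> /card_gt0P[q0 _] Xm; have := first_axis_ge Xm.
have -> : ([set: Q]%SET != finset.set0) by apply/set0Pn; exists q0; rewrite inE.
rewrite addn1 leq_eqVlt => /orP[/eqP mE|//]; move: Xm => /axis_flow_arc.
rewrite -mE; under eq_bigl => q do rewrite inE.
by rewrite leNgt -natr1 step_lt.
Qed.

(** Validity on the whole arc-set follows from four tests on the set [A] served,
    one for the facilities other than the first one and one for each level of
    the staircase; more units of a facility only increase the right-hand side. *)
Lemma first_rest_valid (alpha : Q -> R) (beta gamma : R) :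
  0 <= beta -> 0 <= r%:R + gamma ->
  (forall A, \sum_(q in A) alpha q <= beta + gamma) ->
  (forall A, A <> [set: Q]%SET -> \sum_(q in A) alpha q <= r%:R + 1 + gamma) ->
  \sum_q alpha q <= r%:R + 2 + gamma ->
  forall z, X z -> violation (first_rest_ineq n alpha beta gamma) z <= 0.
Proof.
move=> beta0 V0 Vrest V1 V2 z Xz; have [S1|[A [m zE]]] := flow_arc_cases Xz.
  rewrite violation_first_rest; have [z01 zN _] := Xz.
  have y0 : 0 <= (z.2 ord0 : R) by have [m ->] := zN ord0.
  have := Vrest [set q | z.1 q == 1 :> R]%SET.
  have -> : \sum_(q in [set q | z.1 q == 1 :> R]%SET) alpha q = \sum_q alpha q * z.1 q.
    rewrite big_mkcond; apply: eq_bigr => q _; rewrite inE.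
    by case: (z01 q) => ->; rewrite ?eqxx ?mulr1// eq_sym oner_eq0 mulr0.
  move=> Vz; have : beta <= beta * \sum_(t | t != ord0) (z.2 t : R).
    by rewrite -[leLHS]mulr1 ler_wpM2l.
  move: y0 Vz; set y : R := z.2 ord0; set S := beta * _; set u := \sum_q _.
  by clearbody y S u; lra.
rewrite zE in Xz *; rewrite violation_axis /= mul1r.
have := first_axis_ge Xz; have [A0|/set0Pn[q _]] := eqVneq A finset.set0.
  by rewrite addn0 -(ler_nat R) A0 big_set0; lra.
rewrite addn1 -(ler_nat R) -natr1 => m1.
have [AT|/eqP/V1] := eqVneq A [set: Q]%SET; last by lra.
have Q_gt0 : (0 < #|Q|)%N by apply/card_gt0P; exists q.
move: Xz; rewrite AT => /(first_full_ge Q_gt0); rewrite -(ler_nat R) -[r.+2]addn2 natrD.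
by under eq_bigl => q' do rewrite inE; lra.
Qed.

Lemma first_rest_feasible (alpha : Q -> R) (beta gamma : R) :
  0 <= beta ->
  (forall z, X z -> violation (first_rest_ineq n alpha beta gamma) z <= 0) ->
  separation_feasible P (first_rest_ineq n alpha beta gamma).
Proof.
move=> beta0 valid; split=> [v [Pv _]|/=|t /= /negPf ->]; rewrite ?eqxx//.
exact: conv_hull_le0 (@violation_affine _ _ _ _) valid v Pv.
Qed.

(** * Upper bounds for the separation problem *)

Section Bound.
Context (J : ineq R Q n) (Jf : separation_feasible P J).
Context (xbar : {ffun Q -> R^o}) (ybar : {ffun 'I_n.+1 -> R^o}).
Context (x01 : forall q, 0 <= (xbar q : R) <= 1) (y_ge0 : forall t, 0 <= (ybar t : R)).
Context (s : R) (sE : s = \sum_(t | t != ord0) (ybar t : R)) (s_lt1 : s < 1).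
Let U q : R := Order.max 0 ((xbar q : R) - s).

Lemma s_ge0 : 0 <= s. Proof. by rewrite sE; exact: sumr_ge0. Qed.

Lemma excess_itv q : 0 <= U q <= 1 - s.
Proof.
have /andP[x0 x1] := x01 q; have := s_ge0; rewrite /U => s0.
have s1 := s_lt1.
by case: (leP 0 ((xbar q : R) - s)) => ?; apply/andP; split; lra.
Qed.

Lemma reduced_itv q : 0 <= (xbar q : R) - U q <= s.
Proof.
have /andP[x0 x1] := x01 q; have := s_ge0; rewrite /U => s0.
by case: (leP 0 ((xbar q : R) - s)) => ?; apply/andP; split; lra.
Qed.

(** With [xbar = (xbar - U) + U], the part [xbar - U] is dominated by the axis
    points of the facilities [t != ord0]: among the sets [A], which all are
    served by one unit of [t], the set of the positive coefficients is the
    worst, hence [box_bound]. *)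
Lemma violation_bound (G : R) :
  \sum_q ialpha J q * U q <= (1 - s) * (igamma J + r%:R) + G ->
  violation J (xbar, ybar) <= (1 - s) * r%:R + G - ybar ord0.
Proof.
move=> UG; have [_ J1 _] := Jf.
pose A := [set q | 0 < ialpha J q]%SET.
have rest t : t != ord0 -> \sum_(q in A) ialpha J q - ibeta J t - igamma J <= 0.
  by move=> /(mem_rest A) /(feasible_axis Jf); rewrite violation_axis mulr1.
have restsum : s * (\sum_(q in A) ialpha J q) -
    \sum_(t | t != ord0) ibeta J t * ybar t - s * igamma J <= 0.
  rewrite sE [_ * igamma J]mulr_suml mulr_suml -!sumrB -oppr_ge0 -sumrN.
  apply: sumr_ge0 => t /rest; have := y_ge0 t; set y := ybar t : R; nra.
have := box_bound (ialpha J) reduced_itv; rewrite -/A => low.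
have split_x : \sum_q ialpha J q * xbar q =
    \sum_q ialpha J q * ((xbar q : R) - U q) + \sum_q ialpha J q * U q.
  by rewrite -big_split; apply: eq_bigr => q _ /=; rewrite -mulrDr subrK.
rewrite /violation /= split_x (bigD1 ord0)//= J1 mul1r.
move: UG restsum low; lra.
Qed.

Lemma coef_level0 : 0 <= igamma J + r%:R.
Proof.
have [_ J1 _] := Jf; have := feasible_axis Jf mem_first0.
by rewrite violation_axis big_set0 J1; lra.
Qed.

Lemma coef_level1 A : A <> [set: Q]%SET ->
  \sum_(q in A) ialpha J q <= igamma J + r%:R + 1.
Proof.
have [_ J1 _] := Jf; move=> /mem_first1 /(feasible_axis Jf).
by rewrite violation_axis J1 -natr1; lra.
Qed.

Lemma coef_level2 : \sum_q ialpha J q <= igamma J + r%:R + 2.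
Proof.
have [_ J1 _] := Jf; have := feasible_axis Jf (mem_first2 [set: Q]%SET).
rewrite violation_axis J1 -[r.+2]addn2 natrD; under eq_bigl => q do rewrite inE.
lra.
Qed.

(** [G] plays the role of [(1 - s)] times the height above level [r] at which
    the staircase passes through the scaled excess. *)
Lemma violation_bound_punctured (G : R) :
  0 <= G <= 1 - s -> (forall q, (xbar q : R) - s <= G) ->
  \sum_q U q <= (N - 1) * G ->
  violation J (xbar, ybar) <= (1 - s) * r%:R + G - ybar ord0.
Proof.
move=> /andP[G0 Gs] xG sumU; apply: violation_bound.
have := @punctured_box_bound _ _ (ialpha J) U G _ coef_level1 G0 _ sumU.
have UG q : 0 <= U q <= G.
  by have /andP[-> _] := excess_itv q; rewrite /U ge_max G0 xG.
by move=> /(_ UG); have := coef_level0; nra.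
Qed.

Lemma violation_bound_corner :
  (forall q, s <= (xbar q : R)) -> N - 1 <= \sum_q (xbar q : R) - s ->
  violation J (xbar, ybar) <=
  (1 - s) * r%:R + (\sum_q (xbar q : R) - s * 2 - N + 2) - ybar ord0.
Proof.
move=> xs sum_x; apply: violation_bound.
have UE q : U q = (xbar q : R) - s by rewrite /U max_r// subr_ge0.
have sumUE : \sum_q U q = \sum_q (xbar q : R) - N * s.
  by under eq_bigr do rewrite UE; rewrite sumrB sum_const.
have almost q : \sum_q' ialpha J q' - ialpha J q <= igamma J + r%:R + 1.
  apply: le_trans (coef_level1 (@setC1_neqT _ q)); rewrite (bigD1 q)//=.
  rewrite addrAC subrr add0r.
  by under [leRHS]eq_bigl => q' do rewrite !inE.
have := @corner_bound _ _ (ialpha J) U (1 - s) _ coef_level2 almost.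
rewrite sumUE; move=> H; apply: le_trans (H _ _) _; last by lra.
- by move=> q; have /andP[] := excess_itv q.
- by lra.
Qed.

End Bound.

(** If [Q] had a single element [q], level [r + 1] would already serve it, as
    [a q <= b ord0]. *)
Lemma card_neq1 : #|Q| <> 1%N.
Proof.
move=> /eqP /fintype1P[q Qq].
have := step_lt q; have := a_le q; have := r_feasible.
rewrite (bigD1 q)//= big1 => [|q']; last by rewrite (Qq q') eqxx.
by rewrite addr0; lra.
Qed.

(** * Validity of the five inequalities *)

Lemma zero_valid z : X z ->
  violation (first_rest_ineq n (fun _ : Q => 0) r%:R (- r%:R)) z <= 0.
Proof.
have := ler0n R r => r0.
by apply: first_rest_valid => //= *; rewrite ?big1 //; lra.
Qed.

Lemma single_valid d z : X z ->
  violation (first_rest_ineq n (fun q => (q == d)%:R) (r%:R + 1) (- r%:R)) z <= 0.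
Proof.
have r0 := ler0n R r.
have le1 A : \sum_(q in A) (q == d)%:R <= 1 :> R.
  rewrite big_mkcond (bigD1 d)//= eqxx big1 => [|q /negPf ->]; last by case: ifP.
  by rewrite addr0; case: ifP.
have le1' := le1 [set: Q]%SET.
apply: first_rest_valid => [|| A |A _|]; try have := le1 A; try lra.
by move: le1'; under eq_bigl => q do rewrite inE; lra.
Qed.

Lemma sum_valid z : (#|Q| <= 2)%N -> X z ->
  violation (first_rest_ineq n (fun _ : Q => 1) (r%:R + N) (- r%:R)) z <= 0.
Proof.
rewrite -(ler_nat R) => N2; have r0 := ler0n R r; have N0 := ler0n R #|Q|.
apply: first_rest_valid => [|| A |A /(card_proper_le R)|]; rewrite ?sum1_A; try lra.
  by have := max_card (mem A); rewrite -(ler_nat R); lra.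
by rewrite sum_const; lra.
Qed.

Lemma average_valid z : (3 <= #|Q|)%N -> X z ->
  violation (first_rest_ineq n (fun _ : Q => 1 / (N - 1))
    (r%:R + N / (N - 1)) (- r%:R)) z <= 0.
Proof.
rewrite -(ler_nat R) => N3; have r0 := ler0n R r.
have N1 : 0 < N - 1 by lra.
apply: first_rest_valid => [|| A |A /(card_proper_le R)|]; rewrite ?sum_average.
- by rewrite addr_ge0// divr_ge0// ltW.
- lra.
- have : #|A|%:R / (N - 1) <= N / (N - 1); last by lra.
  by rewrite ler_pM2r ?invr_gt0// ler_nat max_card.
- move=> AN; have : #|A|%:R / (N - 1) <= 1; last by lra.
  by rewrite ler_pdivrMr// mul1r.
- rewrite sum_const mulrA mulr1; have : N / (N - 1) <= 2; last by lra.
  by rewrite ler_pdivrMr//; lra.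
Qed.

Lemma total_valid z : (3 <= #|Q|)%N -> X z ->
  violation (first_rest_ineq n (fun _ : Q => 1) (r%:R + 2) (- r%:R + N - 2)) z <= 0.
Proof.
rewrite -(ler_nat R) => N3; have r0 := ler0n R r.
apply: first_rest_valid => [|| A |A /(card_proper_le R)|]; rewrite ?sum1_A; try lra.
  by have := max_card (mem A); rewrite -(ler_nat R); lra.
by rewrite sum_const; lra.
Qed.

(** * Optimality of the five inequalities *)

Section Solve.
Context (xbar : {ffun Q -> R^o}) (ybar : {ffun 'I_n.+1 -> R^o}).
Context (x01 : forall q, 0 <= (xbar q : R) <= 1) (y_ge0 : forall t, 0 <= (ybar t : R)).
Context (s : R) (sE : s = \sum_(t | t != ord0) (ybar t : R)) (s_lt1 : s < 1).
Local Notation solves := (solves_separation P (xbar, ybar)).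
Local Notation sumx := (\sum_q (xbar q : R)).

Lemma solvesI alpha beta gamma :
  let I := first_rest_ineq n alpha beta gamma in
  0 <= beta -> (forall z, X z -> violation I z <= 0) ->
  (forall J, separation_feasible P J -> violation J (xbar, ybar) <=
    \sum_q alpha q * xbar q - ybar ord0 - beta * s - gamma) ->
  solves I.
Proof.
move=> I beta0 valid opt; split; first exact: first_rest_feasible.
by move=> J /opt; rewrite violation_first_rest /= -sE.
Qed.

Lemma zero_solves : (forall q, (xbar q : R) <= s) ->
  solves (first_rest_ineq n (fun _ : Q => 0) r%:R (- r%:R)).
Proof.
move=> xs; apply: solvesI => [|z|J Jf]; [exact: ler0n|exact: zero_valid|].
have := @violation_bound_punctured J Jf xbar ybar x01 y_ge0 s sE s_lt1 0.
have -> : \sum_q Order.max 0 ((xbar q : R) - s) = 0.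
  by apply: big1 => q _; rewrite max_l// subr_le0.
rewrite mulr0 big1 => [|q _]; last by rewrite mul0r.
have s1 := s_lt1 => H; apply: le_trans (H _ _ _) _ => // [|q|]; last by lra.
- by apply/andP; split; lra.
- by rewrite subr_le0.
Qed.

(** The condition on the total excess states that the excess, scaled by
    [xbar d - s], satisfies the cut that removes the full corner.  It holds when
    some excess vanishes, and also when [(N - 1) * xbar d] is at least the sum
    of the [xbar q] minus [s]. *)
Lemma single_solves d : (forall q, (xbar q : R) <= xbar d) -> s <= (xbar d : R) ->
  \sum_q Order.max 0 ((xbar q : R) - s) <= (N - 1) * ((xbar d : R) - s) ->
  solves (first_rest_ineq n (fun q => (q == d)%:R) (r%:R + 1) (- r%:R)).
Proof.
move=> dmax sd sumU; apply: solvesI => [|z|J Jf].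
- by have := ler0n R r; lra.
- exact: single_valid.
have /andP[_ xd1] := x01 d.
have := @violation_bound_punctured J Jf xbar ybar x01 y_ge0 s sE s_lt1 ((xbar d : R) - s).
have -> : \sum_q (q == d)%:R * xbar q = (xbar d : R).
  rewrite (bigD1 d)//= eqxx mul1r big1 ?addr0// => q /negPf ->.
  by rewrite mul0r.
have s1 := s_lt1 => H; apply: le_trans (H _ _ sumU) _ => // [|q|]; last by lra.
- by apply/andP; split; lra.
- by rewrite lerD2r.
Qed.

(** For two elements the bounds of [punctured_box_bound], taken with [G] the
    total excess, and of [corner_bound] agree, so a single inequality is optimal
    on both sides of the cut. *)
Lemma sum_solves : (#|Q| <= 2)%N -> (forall q, s <= (xbar q : R)) ->
  solves (first_rest_ineq n (fun _ : Q => 1) (r%:R + N) (- r%:R)).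
Proof.
move=> N2 sx; apply: solvesI => [|z|J Jf].
- by have := ler0n R r; have := ler0n R #|Q|; lra.
- exact: sum_valid.
have s1 := s_lt1.
have sumU := sum_excess sx; set G := \sum_q Order.max _ _ in sumU.
have N02 : #|Q| = 0%N \/ N = 2.
  have := card_neq1; move: N2; case: #|Q| => [|[|[|]]]//= _ _; first by left.
  by right.
have sum1x : \sum_q 1 * xbar q = sumx by apply: eq_bigr => q _; rewrite mul1r.
rewrite sum1x.
have G0 : 0 <= G by apply: sumr_ge0 => q _; rewrite le_max lexx.
have GN : G <= (N - 1) * G.
  have [N0|->] := N02; last by lra.
  suff -> : G = 0 by rewrite mulr0.
  by rewrite /G big_pred0 // => q; have := card0_eq N0 q.
(* The scaled excess lies below or above the cut through the full corner. *)
have [Gs|Gs] := leP G (1 - s).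
  have := @violation_bound_punctured J Jf xbar ybar x01 y_ge0 s sE s_lt1 G.
  move=> H; apply: le_trans (H _ _ GN) _ => // [|q|]; last by lra.
  - by apply/andP; split; lra.
  - rewrite /G (bigD1 q)//= ler_wpDr// ?le_max ?lexx ?orbT//.
    by apply: sumr_ge0 => q' _; rewrite le_max lexx.
have NE : N = 2.
  have [N0|//] := N02.
  have G00 : G = 0 by rewrite /G big_pred0 // => q; have := card0_eq N0 q.
  by lra.
apply: le_trans (@violation_bound_corner J Jf xbar ybar x01 y_ge0 s sE s_lt1 sx _) _.
  by rewrite NE in sumU *; lra.
by rewrite NE; lra.
Qed.

(** The smallest [G] allowed by the cut is [g - s], where [g] is the average
    [sigma]; it is admissible because [g] dominates every [xbar q]. *)
Lemma average_solves d : (3 <= #|Q|)%N -> (forall q, s <= (xbar q : R)) ->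
  (forall q, (xbar q : R) <= xbar d) ->
  (xbar d : R) <= (sumx - s) / (N - 1) <= 1 ->
  solves (first_rest_ineq n (fun _ : Q => 1 / (N - 1))
    (r%:R + N / (N - 1)) (- r%:R)).
Proof.
move=> N3 sx dmax /andP[]; set g := (sumx - s) / (N - 1) => gd g1.
have N3' : 3 <= N by rewrite ler_nat.
apply: solvesI => [|z|J Jf].
- by rewrite addr_ge0// divr_ge0//; lra.
- exact: average_valid.
have s1 := s_lt1; have sd := sx d.
have N1 : N - 1 != 0 by rewrite gt_eqF//; lra.
have gE : (N - 1) * g = sumx - s by rewrite /g mulrCA divff // mulr1.
have sumU := sum_excess sx.
have := @violation_bound_punctured J Jf xbar ybar x01 y_ge0 s sE s_lt1 (g - s).
rewrite sumU => H; apply: le_trans (H _ _ _) _ => // [|q||].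
- by apply/andP; split; lra.
- by rewrite lerD2r (le_trans (dmax q)).
- by lra.
rewrite -mulr_sumr.
have -> : N / (N - 1) = 1 + 1 / (N - 1).
  by rewrite -{1}[N](subrK 1) mulrDl divff //.
rewrite (_ : 1 / (N - 1) * sumx = g + (N - 1)^-1 * s); last first.
  by rewrite mul1r /g (mulrC _ s) -mulrDl subrK mulrC.
lra.
Qed.

Lemma total_solves : (3 <= #|Q|)%N -> (forall q, s <= (xbar q : R)) ->
  1 <= (sumx - s) / (N - 1) ->
  solves (first_rest_ineq n (fun _ : Q => 1) (r%:R + 2) (- r%:R + N - 2)).
Proof.
move=> N3 sx; have N3' : 3 <= N by rewrite ler_nat.
rewrite ler_pdivlMr ?mul1r; last by lra.
move=> sumN; apply: solvesI => [|z|J Jf].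
- by have := ler0n R r; lra.
- exact: total_valid.
apply: le_trans (@violation_bound_corner J Jf xbar ybar x01 y_ge0 s sE s_lt1 sx sumN) _.
have -> : \sum_q 1 * xbar q = sumx by apply: eq_bigr => q _; rewrite mul1r.
lra.
Qed.

End Solve.

(** * The five facets *)

Section Facets.
Context (t0 : 'I_n.+1) (t0_neq0 : t0 != ord0).
Local Notation facet := (@defines_facet R Q n P).
Local Notation xunit := (@xunit R Q n).
Local Notation yunit := (@yunit R Q n).

Lemma mem_firstS A k : X (axis_point A ord0 k) -> X (axis_point A ord0 k + yunit ord0).
Proof. by rewrite axis_pointS; exact: mem_first_mono. Qed.

Lemma zero_facet : facet (first_rest_ineq n (fun _ : Q => 0) r%:R (- r%:R)).
Proof.
apply: (@facet_criterion _ _ _ X _ (axis_point finset.set0 ord0 r)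
  (fun q => axis_point [set q]%SET t0 1)
  (fun t => axis_point finset.set0 (lift ord0 t) 1)).
- by [].
- exact: zero_valid.
- exact: mem_first0.
- exact/mem_firstS/mem_first0.
- by move=> q; exact: mem_rest.
- by move=> t; apply: mem_rest; rewrite eq_sym neq_lift.
- by rewrite violation_axis big_set0 /=; lra.
- by move=> q; rewrite violation_axis big1//= (negPf t0_neq0); lra.
- by move=> t; rewrite violation_axis big1//=; lra.
move=> V yV; have p0V : axis_point finset.set0 ord0 r \in V.
  by rewrite mem_axis_first// big_set0 rpred0.
move=> pQ pT.
have yT t : yunit (lift ord0 t) \in V.
  by have := pT t; rewrite rpredBr// axis_pointE big_set0 add0r scale1r.
split=> // q; have := pQ q; rewrite rpredBr// axis_pointE big_set1 scale1r.
by rewrite rpredDr//; case: (unliftP ord0 t0) t0_neq0 => [t ->|->].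
Qed.

Lemma single_facet d : (2 <= #|Q|)%N ->
  facet (first_rest_ineq n (fun q => (q == d)%:R) (r%:R + 1) (- r%:R)).
Proof.
move=> Q2.
have dT : [set d]%SET <> [set: Q]%SET.
  by move=> dT; rewrite -cardsT -dT cards1 in Q2.
have sumd A : d \in A -> \sum_(q in A) (q == d)%:R = 1 :> R.
  move=> dA; rewrite (bigD1 d)//= eqxx big1 ?addr0// => q /andP[_ /negPf ->//].
have dd : d \in [set d]%SET by rewrite inE.
have dq q : d \in [set d; q]%SET by rewrite !inE eqxx.
(* [set d; q] is served by [t0], as it may be [Q], which level [r + 1] excludes. *)
apply: (@facet_criterion _ _ _ X _ (axis_point finset.set0 ord0 r)
  (fun q => if q == d then axis_point [set d]%SET ord0 r.+1
            else axis_point [set d; q]%SET t0 1)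
  (fun t => axis_point [set d]%SET (lift ord0 t) 1)).
- by [].
- exact: single_valid.
- exact: mem_first0.
- exact/mem_firstS/mem_first0.
- by move=> q; case: ifP => _; [exact: mem_first1|exact: mem_rest].
- by move=> t; apply: mem_rest; rewrite eq_sym neq_lift.
- by rewrite violation_axis big_set0 /=; lra.
- move=> q; case: ifP => _; rewrite violation_axis sumd//= ?(negPf t0_neq0).
    by rewrite -natr1; lra.
  lra.
- by move=> t; rewrite violation_axis sumd//=; lra.
move=> V yV; have p0V : axis_point finset.set0 ord0 r \in V.
  by rewrite mem_axis_first// big_set0 rpred0.
move=> pQ pT.
have xd : xunit d \in V.
  by have := pQ d; rewrite eqxx rpredBr// mem_axis_first// big_set1.
have yT t : yunit (lift ord0 t) \in V.
  by have := pT t; rewrite rpredBr// axis_pointE big_set1 scale1r rpredDl.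
split=> // q; have := pQ q; case: eqP => [->//|/eqP qd].
rewrite rpredBr// axis_pointE scale1r rpredDr; last first.
  by case: (unliftP ord0 t0) t0_neq0 => [t ->|->].
by rewrite big_setU1 ?inE 1?eq_sym// big_set1 rpredDl.
Qed.

Lemma sum_facet : (#|Q| <= 2)%N ->
  facet (first_rest_ineq n (fun _ : Q => 1) (r%:R + N) (- r%:R)).
Proof.
move=> Q2.
have xT q : [set q]%SET <> [set: Q]%SET.
  move=> /(congr1 (fun A : {set Q} => #|A|)); rewrite cards1 cardsT => /esym.
  exact: card_neq1.
apply: (@facet_criterion _ _ _ X _ (axis_point finset.set0 ord0 r)
  (fun q => axis_point [set q]%SET ord0 r.+1)
  (fun t => axis_point [set: Q]%SET (lift ord0 t) 1)).
- by [].
- by move=> z; exact: sum_valid.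
- exact: mem_first0.
- exact/mem_firstS/mem_first0.
- by move=> q; exact: mem_first1.
- by move=> t; apply: mem_rest; rewrite eq_sym neq_lift.
- by rewrite violation_axis big_set0 /=; lra.
- by move=> q; rewrite violation_axis big_set1 /= -natr1; lra.
- by move=> t; rewrite violation_axis sum1_A cardsT /=; lra.
move=> V yV; have p0V : axis_point finset.set0 ord0 r \in V.
  by rewrite mem_axis_first// big_set0 rpred0.
move=> pQ pT.
have xV q : xunit q \in V.
  by have := pQ q; rewrite rpredBr// mem_axis_first// big_set1.
split=> // t; have := pT t; rewrite rpredBr// axis_pointE scale1r rpredDl//.
by rewrite rpred_sum.
Qed.

(** The indicators of the complements of points generate the indicator of [Q],
    since they add up to [N - 1] times it, and [N != 1]. *)
Lemma average_facet : (3 <= #|Q|)%N ->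
  facet (first_rest_ineq n (fun _ : Q => 1 / (N - 1)) (r%:R + N / (N - 1)) (- r%:R)).
Proof.
move=> Q3; have : 3 <= N by rewrite ler_nat.
move=> N3; have N1 : N - 1 != 0 by rewrite gt_eqF//; lra.
apply: (@facet_criterion _ _ _ X _ (axis_point finset.set0 ord0 r)
  (fun q => axis_point [set~ q]%SET ord0 r.+1)
  (fun t => axis_point [set: Q]%SET (lift ord0 t) 1)).
- by [].
- by move=> z; exact: average_valid.
- exact: mem_first0.
- exact/mem_firstS/mem_first0.
- by move=> q; apply: mem_first1; exact: setC1_neqT.
- by move=> t; apply: mem_rest; rewrite eq_sym neq_lift.
- by rewrite violation_axis big_set0 /=; lra.
- by move=> q; rewrite violation_axis sum_average card_setC1R divff//= -natr1; lra.
- by move=> t; rewrite violation_axis sum_average cardsT /=; lra.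
move=> V yV; have p0V : axis_point finset.set0 ord0 r \in V.
  by rewrite mem_axis_first// big_set0 rpred0.
move=> pQ pT.
have xC q : \sum_(q' in [set~ q]%SET) xunit q' \in V.
  by have := pQ q; rewrite rpredBr// mem_axis_first.
have xT : \sum_(q in [set: Q]%SET) xunit q \in V.
  have : \sum_q \sum_(q' in [set~ q]%SET) xunit q' \in V by rewrite rpred_sum.
  have -> : \sum_q \sum_(q' in [set~ q]%SET) xunit q' =
      (N - 1) *: \sum_(q in [set: Q]%SET) xunit q.
    transitivity (\sum_q (\sum_(q' in [set: Q]%SET) xunit q' - xunit q)).
      by apply: eq_bigr => q _; rewrite (sum_xunit_setT _ _ q) addrAC subrr add0r.
    rewrite sumrB sumr_const scalerBl scale1r scaler_nat; congr (_ - _).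
    by apply: eq_bigl => q; rewrite inE.
  by rewrite rpredZeq (negPf N1).
split=> [q|t].
  by have := xT; rewrite (sum_xunit_setT _ _ q) rpredDr.
by have := pT t; rewrite rpredBr// axis_pointE scale1r rpredDl.
Qed.

(** Level [r] is not tight here, and the base point is the full corner at level
    [r + 2]. *)
Lemma total_facet : (3 <= #|Q|)%N ->
  facet (first_rest_ineq n (fun _ : Q => 1) (r%:R + 2) (- r%:R + N - 2)).
Proof.
move=> Q3.
apply: (@facet_criterion _ _ _ X _ (axis_point [set: Q]%SET ord0 r.+2)
  (fun q => axis_point [set~ q]%SET ord0 r.+1)
  (fun t => axis_point [set: Q]%SET (lift ord0 t) 1)).
- by [].
- by move=> z; exact: total_valid.
- exact: mem_first2.
- exact/mem_firstS/mem_first2.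
- by move=> q; apply: mem_first1; exact: setC1_neqT.
- by move=> t; apply: mem_rest; rewrite eq_sym neq_lift.
- by rewrite violation_axis sum1_A cardsT /= -[r.+2]addn2 natrD; lra.
- by move=> q; rewrite violation_axis sum1_A card_setC1R /= -natr1; lra.
- by move=> t; rewrite violation_axis sum1_A cardsT /=; lra.
move=> V yV pQ pT; split=> [q|t].
  have -> : xunit q = - (axis_point [set~ q]%SET ord0 r.+1 -
      axis_point [set: Q]%SET ord0 r.+2) - yunit ord0.
    have -> : axis_point [set: Q]%SET ord0 r.+2 =
        xunit q + axis_point [set~ q]%SET ord0 r.+1 + yunit ord0.
      by rewrite -axis_pointS !axis_pointE (sum_xunit_setT _ _ q) addrA.
    by rewrite opprB addrAC addrK addrK.
  by rewrite rpredB// rpredN.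
have := pT t; rewrite !axis_pointE scale1r opprD addrACA subrr add0r.
by rewrite rpredBr// rpredZ.
Qed.

End Facets.
End Staircase.

(** * The separation theorem *)

Lemma first_level (R : realType) (b1 c : R) : 0 < b1 ->
  exists r : nat, [/\ (Order.max (Num.ceil (- c / b1)) 0)%:~R = r%:R :> R,
    0 <= b1 * r%:R + c
  & forall m : nat, 0 <= b1 * m%:R + c -> (r <= m)%N].
Proof.
move=> b1_gt0; set z := Order.max _ _.
have z_ge0 : 0 <= z by rewrite le_max lexx orbT.
have zE : z = `|z|%N by rewrite gez0_abs.
exists `|z|%N; split; first by rewrite {1}zE.
  have : - c / b1 <= z%:~R.
    by apply: le_trans (ceil_ge _) _; rewrite ler_int le_max lexx.
  by rewrite zE ler_pdivrMr// mulrC; lra.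
move=> m bm; rewrite -lez_nat -zE ge_max ceil_le_int andbC /= ler_pdivrMr//.
by rewrite mulrC; lra.
Qed.

Theorem proposition8 (R : realType) (Q : finType) (n : nat)
    (a : Q -> R) (b : 'I_n.+1 -> R) (c : R)
    (a_gt0 : forall q, 0 < a q)
    (b1_gt0 : 0 < b ord0)
    (b_mono : forall s t : 'I_n.+1, (s <= t)%N -> b s <= b t)
    (suma_gt_c : 0 < \sum_q a q - c)
    (xbar : {ffun Q -> R^o}) (ybar : {ffun 'I_n.+1 -> R^o})
    (zbar_LP : flow_arc_LP a b c (xbar, ybar)) :
  let r : R := (Order.max (Num.ceil (- c / b ord0)) 0)%:~R in
  let P := flow_arc_polyhedron a b c in
  let s : R := \sum_(t | t != ord0) (ybar t : R) in
  let Qt := [set q | s < xbar q]%SET in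
  let N : R := #|Q|%:R in
  let argmax d := forall q, xbar q <= xbar d in
  let solves I := solves_separation P (xbar, ybar) I in
  let facet I := defines_facet P I in
  (2 <= #|'I_n.+1|)%N ->
  (forall q, a q <= b ord0) ->
  (forall q, b ord0 * r + c < a q) ->
  (forall t, t != ord0 -> \sum_q a q <= b t + c) ->
  (forall q0, \sum_q a q - a q0 <= b ord0 * (r + 1) + c < \sum_q a q) ->
  s < 1 ->
  [/\ Qt = finset.set0 ->
        let I := first_rest_ineq n (fun _ : Q => 0) r (- r) in
        solves I /\ facet I,
      Qt <> finset.set0 -> Qt <> [set: Q]%SET -> forall d, argmax d ->
        let I := first_rest_ineq n (fun q => (q == d)%:R) (r + 1) (- r) in
        solves I /\ facet I,
      Qt = [set: Q]%SET -> (#|Q| <= 2)%N ->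
        let I := first_rest_ineq n (fun _ : Q => 1) (r + N) (- r) in
        solves I /\ facet I
    & Qt = [set: Q]%SET -> (3 <= #|Q|)%N -> forall d, argmax d ->
        let sigma : R := (\sum_q (xbar q : R) - s) / (N - 1) in
        let I1 := first_rest_ineq n (fun q => (q == d)%:R) (r + 1) (- r) in
        let I2 := first_rest_ineq n (fun _ : Q => 1 / (N - 1))
                    (r + N / (N - 1)) (- r) in
        let I3 := first_rest_ineq n (fun _ : Q => 1) (r + 2) (- r + N - 2) in
        [/\ sigma <= xbar d -> solves I1,
            xbar d < sigma <= 1 -> solves I2,
            1 < sigma -> solves I3
          & [/\ facet I1, facet I2 & facet I3]]].
Proof.
move=> r P s Qt N argmax solves facet T2 a_le lt_a big_b step s_lt1.
have [x01 y_ge0 _] : flow_arc_LP a b c (xbar, ybar) := zbar_LP.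
rewrite /= in x01 y_ge0.
have [r0 [rE r_feasible r_min]] := first_level c b1_gt0.
rewrite -/r in rE; clearbody r; subst r.
have step_ge q0 : \sum_q a q - a q0 <= b ord0 * (r0%:R + 1) + c.
  by case/andP: (step q0).
have step_lt (q0 : Q) : b ord0 * (r0%:R + 1) + c < \sum_q a q.
  by case/andP: (step q0).
have St : staircase a b c r0.
  by split.
have t0_neq0 : (ord_max : 'I_n.+1) != ord0.
  by rewrite card_ord in T2; rewrite -val_eqE /= -lt0n.
have Qt_all : Qt = [set: Q]%SET -> forall q, s <= (xbar q : R).
  by move=> /setP QT q; have := QT q; rewrite !inE => /ltW.
split.
- move=> /setP Q0 I; split; last by apply: (zero_facet St t0_neq0) => //.
  apply: (zero_solves St) => // q; have := Q0 q; rewrite !inE => /negbT.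
  by rewrite -leNgt.
- move=> /eqP/set0Pn[q]; rewrite inE => sq.
  move=> /eqP; rewrite -properT => /properP[_ [q1 _]]; rewrite inE -leNgt => q1s.
  move=> d dmax I.
  have sd : s <= (xbar d : R) by apply: le_trans (ltW sq) (dmax q).
  split; last first.
    apply: (single_facet St t0_neq0) => //; apply/card_gt1P; exists q, q1; split=> //.
    by apply: contraTneq sq => ->; rewrite -leNgt.
  apply: (single_solves St) => //.
  (* The excess vanishes at [q1], and is at most [xbar d - s] elsewhere. *)
  rewrite (bigD1 q1)//= max_l ?subr_le0// add0r.
  have -> : (N - 1) * ((xbar d : R) - s) = \sum_(q | q != q1) ((xbar d : R) - s).
    by rewrite mulrBl mul1r -sum_const [X in X - _](bigD1 q1)//= addrAC subrr add0r.
  by apply: ler_sum => q' _; rewrite ge_max subr_ge0 sd lerD2r dmax.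
- move=> /Qt_all sx Q2 I; split; first by apply: (sum_solves St) => //.
  by apply: (sum_facet St) => //.
- move=> /Qt_all sx Q3 d dmax sigma I1 I2 I3.
  have N1 : 0 < N - 1 by rewrite subr_gt0 ltr1n (ltn_trans _ Q3).
  split.
  + rewrite ler_pdivrMr// => sigma_le; apply: (single_solves St) => //.
    rewrite sum_excess// -/N.
    exact: average_shift.
  + move=> /andP[/ltW dsigma sigma1].
    by apply: (average_solves St _ _ _ _ _ _ dmax) => //; apply/andP.
  + by move=> /ltW sigma1; apply: (total_solves St).
  + split; [apply: (single_facet St t0_neq0) => //| |]; first exact: ltnW.
    * by apply: (average_facet St).
    * by apply: (total_facet St).
Qed.
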